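(* For every $\alpha\in[0,1]$, there is no auction in the Prediction or Any-Previously-Seen (PA) family that is $\alpha$-consistent and $\left(\frac{1-\alpha^2}{4}+\omega\left(\frac1n\right)\right)$-robust. That is, for every $\alpha\in[0,1]$ there do not exist a function $g$ with $g(n)=\omega(1/n)$ (i.e. $n\,g(n)\to\infty$) and a sequence $(M_n)_{n}$ such that for every $n$, $M_n$ is a PA auction for $n$ bidders that is $\alpha$-consistent and $\left(\frac{1-\alpha^2}{4}+g(n)\right)$-robust.
   Context: One item is sold to $n$ bidders arriving one at a time with non-overlapping active times (bidder $i$ arrives and departs at step $i\in[n]$). An instance $V$ is a multiset of $n$ nonnegative values; $v_{(1)}$ and $v_{(2)}$ are its highest and second-highest values. The values $\mathbf v=(v_1,\dots,v_n)$ of the successive bidders are a uniformly random ordering of $V$. The auction also receives a prediction $\tilde v_{(1)}\ge 0$ of $v_{(1)}$. Let $v^{<i}_{(j)}$ be the $j$-th highest value among $v_1,\dots,v_{i-1}$. Allocation rules for bidder $i$: $a_1^i$ never allocates to $i$; for $j\in[i-1]$, $a_{2,j}^i$ allocates to $i$ iff $v_i\ge\max\{\tilde v_{(1)},v^{<i}_{(j)}\}$; for $j\in[i-1]$, $a_{3,j}^i$ allocates to $i$ iff $v_i\ge v^{<i}_{(j)}$. Let $A^i=\{a_1^i\}\cup\{a_{2,j}^i\}_{j\in[i-1]}\cup\{a_{3,j}^i\}_{j\in[i-1]}$. An auction is in the PA family if for every bidder $i\in[n]$ there is a rule $a^i\in A^i$ such that, if the item was not allocated to a bidder $j<i$, the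 auction allocates to $i$ according to $a^i$. Being a posted-price auction, the price paid by the winner $i$ is the threshold of her rule: $\max\{\tilde v_{(1)},v^{<i}_{(j)}\}$ for $a_{2,j}^i$, and $v^{<i}_{(j)}$ for $a_{3,j}^i$. $\mathrm{Rev}$ is the price paid ($0$ if the item is unsold). An auction is $c$-consistent if for every instance $V$, when $\tilde v_{(1)}=v_{(1)}$, its expected revenue (over the random order) is at least $c\,v_{(1)}$. It is $r$-robust if for every instance $V$ and every prediction $\tilde v_{(1)}\ge0$, its expected revenue is at least $r\,v_{(2)}$. *)

(* Defs.v *)
From HB Require Import structures.
From mathcomp Require Import all_boot all_order all_algebra all_fingroup.
From mathcomp Require Import all_classical all_reals all_analysis.

Set Implicit Arguments.
Unset Strict Implicit.
Unset Printing Implicit Defensive.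

Import Order.TTheory GRing.Theory Num.Theory.
Import numFieldNormedType.Exports.

Local Open Scope ring_scope.

(* Bidders, and ranks among values, are numbered from 0: the bidder [i : 'I_n]
   has exactly [i] predecessors, and rank [0] is the highest value. *)

(* Rules for a bidder with [k] predecessors. [AnySeen j] posts the rank-[j] value
   seen so far; [PredSeen j] posts the maximum of that value and the prediction. *)
Inductive pa_rule (k : nat) : Type :=
  | Never
  | PredSeen of 'I_k
  | AnySeen of 'I_k.

Definition pa_auction (n : nat) : Type := forall i : 'I_n, pa_rule i.

Section Auction.
Variable R : realType.
Implicit Types (s : seq R) (p : R).

(* With multiplicity: tied values occupy several ranks. *)
Definition highest s (j : nat) : R := nth 0 (sort >=%O s) j.

(* [None] means that no price is offered. *)
Definition posted_price (k : nat) (a : pa_rule k) p (past : seq R) : option R :=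
  match a with
  | Never => None
  | PredSeen j => Some (Num.max p (highest past j))
  | AnySeen j => Some (highest past j)
  end.

Section Run.
Variables (n : nat) (M : pa_auction n) (p : R) (v : n.-tuple R).

Definition price (i : 'I_n) : option R := posted_price (M i) p (take i v).

Definition accepts (i : 'I_n) : bool :=
  if price i is Some t then t <= tnth v i else false.

Definition wins (i : 'I_n) : bool :=
  accepts i && [forall j : 'I_n, (j < i)%N ==> ~~ accepts j].

(* At most one bidder wins, so the sum has at most one term. *)
Definition revenue : R := \sum_(i < n | wins i) odflt 0 (price i).

End Run.

(* The multiset V is given by an arbitrary listing of its elements; a uniformly
   random permutation of the listing is a uniformly random ordering of V. *)
Definition arrange (n : nat) (V : n.-tuple R) (s : 'S_n) : n.-tuple R :=
  [tuple tnth V (s i) | i < n].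

Definition expected_revenue (n : nat) (M : pa_auction n) p (V : n.-tuple R) : R :=
  (\sum_(s : 'S_n) revenue M p (arrange V s)) / (n`!)%:R.

Definition is_instance (n : nat) (V : n.-tuple R) : Prop :=
  forall i : 'I_n, 0 <= tnth V i.

Definition consistent (n : nat) (c : R) (M : pa_auction n) : Prop :=
  forall V : n.-tuple R, is_instance V ->
    c * highest V 0 <= expected_revenue M (highest V 0) V.

Definition robust (n : nat) (r : R) (M : pa_auction n) : Prop :=
  forall (V : n.-tuple R) (p : R), is_instance V -> 0 <= p ->
    r * highest V 1 <= expected_revenue M p V.

End Auction.

(* Main.v *)
(** Let [a] be the fraction of bidders with a rule [AnySeen] and [q] the fraction
    with a rule [PredSeen].  On [V = {1, 0, ..., 0}] with a perfect prediction,
    the auction earns only if the value [1] meets a [PredSeen] rule, so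
    [alpha <= q].  On [V = {2, 1, 0, ..., 0}] it earns only if [2] meets an active
    rule and [1] an inactive one, where the active rules are the [AnySeen] ones if
    the prediction is [3], and all but [Never] if it is [0].  The revenue is thus
    at most [x (1 - x) n / (n - 1)] for both [x = a] and [x = a + q].  Since
    [q >= alpha], one of these [x] is at distance at least [alpha / 2] from
    [1 / 2], where [x (1 - x) <= (1 - alpha ^ 2) / 4]. *)
Require Import Defs.
From HB Require Import structures.
From mathcomp Require Import all_boot all_order all_algebra all_fingroup.
From mathcomp Require Import all_classical all_reals all_analysis.
From mathcomp Require Import ring lra.

Import Order.TTheory GRing.Theory Num.Theory.
Import numFieldNormedType.Exports.

Local Open Scope classical_set_scope.
Local Open Scope ring_scope.

(** * Averages over a uniformly random permutation *)

Section PermutationSums.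
Variable R : realType.
Implicit Types n : nat.

(** Composing with a transposition shows that the left sum is the same for every [x]. Summed over
    all [x], each permutation contributes [\sum_i F i] exactly once. *)
Lemma sum_perm_point n (x : 'I_n) (F : 'I_n -> R) :
  n%:R * (\sum_(s : 'S_n) F ((s^-1)%g x)) = n`!%:R * \sum_i F i.
Proof.
have indep y : \sum_(s : 'S_n) F ((s^-1)%g x) = \sum_(s : 'S_n) F ((s^-1)%g y).
  rewrite [RHS](reindex_inj (mulIg (tperm x y))) /=.
  by apply: eq_bigr => s _; rewrite invMg tpermV permM tpermR.
have -> : n%:R * (\sum_(s : 'S_n) F ((s^-1)%g x)) =
          \sum_y \sum_(s : 'S_n) F ((s^-1)%g y).
  rewrite [RHS](eq_bigr (fun=> \sum_(s : 'S_n) F ((s^-1)%g x))) => [|y _].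
    by rewrite sumr_const card_ord mulr_natl.
  by rewrite -indep.
rewrite exchange_big /= (eq_bigr (fun=> \sum_i F i)) => [|s _].
  by rewrite sumr_const card_Sn mulr_natl.
by rewrite [RHS](reindex_inj (@perm_inj _ (s^-1)%g)).
Qed.

Lemma perm_two_transitive n (x y a b : 'I_n) : x != y -> a != b ->
  exists t : 'S_n, t x = a /\ t y = b.
Proof.
(* The left factor acts first: it fixes [x] and sends [y] to the preimage of [b] under
   [tperm x a]. *)
move=> xy ab; exists (tperm y (tperm x a b) * tperm x a)%g.
have cx : tperm x a b != x.
  by rewrite -[X in _ != X](tpermR x a) (inj_eq perm_inj) eq_sym.
have yx : y != x by rewrite eq_sym.
by rewrite !permM tpermL tpermK (tpermD yx cx) tpermL.
Qed.

(** The same averaging, now over the [n * n.-1] ordered pairs of distinct points, which are all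
    alike by double transitivity. *)
Lemma sum_perm_pair n (x y : 'I_n) (F : 'I_n -> 'I_n -> R) : x != y ->
  (n * n.-1)%:R * (\sum_(s : 'S_n) F ((s^-1)%g x) ((s^-1)%g y)) =
  n`!%:R * \sum_i \sum_(k | k != i) F i k.
Proof.
move=> xy; set S := \sum_(s : 'S_n) _.
have indep a b : b != a ->
    \sum_(s : 'S_n) F ((s^-1)%g a) ((s^-1)%g b) = S.
  rewrite eq_sym => ab; have [t [<- <-]] := perm_two_transitive _ _ _ _ _ xy ab.
  rewrite (reindex_inj (mulIg t)) /=.
  by apply: eq_bigr => s _; rewrite invMg !permM !permK.
transitivity (\sum_a \sum_(b | b != a) \sum_(s : 'S_n) F ((s^-1)%g a) ((s^-1)%g b)).
  rewrite [RHS](eq_bigr (fun=> S *+ n.-1)) => [|a _].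
    by rewrite sumr_const card_ord -mulrnA mulr_natl mulnC.
  rewrite (eq_bigr (fun=> S)) => [|b /indep //].
  by rewrite sumr_const cardC1 card_ord.
under eq_bigr do rewrite exchange_big /=.
rewrite exchange_big /= (eq_bigr (fun=> \sum_i \sum_(k | k != i) F i k)) => [|s _].
  by rewrite sumr_const card_Sn mulr_natl.
rewrite [RHS](reindex_inj (@perm_inj _ (s^-1)%g)) /=.
apply: eq_bigr => a _; rewrite [RHS](reindex_inj (@perm_inj _ (s^-1)%g)) /=.
by apply: eq_bigl => b; rewrite (inj_eq perm_inj).
Qed.

End PermutationSums.

(** * Revenue of a single run when at most two values are nonzero *)

Section Revenue.
Variable R : realType.
Implicit Types n : nat.

(** The first alternative covers the default of [nth], for a rank beyond the values seen. *)
Lemma highestP n (v : n.-tuple R) (i : 'I_n) j :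
  highest (take i v) j = 0 \/
  exists2 l : 'I_n, (l < i)%N & highest (take i v) j = tnth v l.
Proof.
rewrite /highest; set s := sort _ _.
have [js|sj] := ltnP j (size s); last by left; rewrite nth_default.
have : nth 0 s j \in take i v by rewrite -(mem_sort >=%O) mem_nth.
case/(nthP 0) => l; rewrite size_take size_tuple ltn_ord => li.
rewrite nth_take // => <-; right.
by exists (Ordinal (ltn_trans li (ltn_ord i))); rewrite // (tnth_nth 0).
Qed.

Lemma highest_ge0 n (v : n.-tuple R) (i : 'I_n) j :
  is_instance v -> 0 <= highest (take i v) j.
Proof. by move=> v0; have [->|[l _ ->]] := highestP n v i j. Qed.

Lemma revenue_le n (M : pa_auction n) p (v : n.-tuple R) c : 0 <= c ->
  (forall w, wins M p v w -> odflt 0 (price M p v w) <= c) ->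
  revenue M p v <= c.
Proof.
move=> c0 le_c; rewrite /revenue; case: (pickP (wins M p v)) => [w ww|no].
  rewrite (bigD1 w) //= big1 ?addr0 ?le_c // => u /andP[wu uw].
  have [/andP[au /forallP nu] /andP[aw /forallP nw]] := (wu, ww).
  case: (ltngtP u w) => [lt|lt|/val_inj eq].
  - by have := nw u; rewrite lt au.
  - by have := nu w; rewrite lt aw.
  - by rewrite eq eqxx in uw.
by rewrite big_pred0.
Qed.

Definition pred_bidders n (M : pa_auction n) : {set 'I_n} :=
  [set i | if M i is PredSeen _ then true else false].

Definition any_bidders n (M : pa_auction n) : {set 'I_n} :=
  [set i | if M i is AnySeen _ then true else false].

Lemma any_pred_disjoint n (M : pa_auction n) :
  any_bidders n M :&: pred_bidders n M = finset.set0.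
Proof. by apply/setP => i; rewrite !inE; case: (M i). Qed.

(** An [AnySeen] price is positive only after [i0] has passed, and then every remaining value is
    [0]. A [PredSeen] price is at least [1], which only [i0] can pay. *)
Lemma revenue_one_value n (M : pa_auction n) (v : n.-tuple R) (i0 : 'I_n) :
  (forall i, tnth v i = (i == i0)%:R) ->
  revenue M 1 v <= (i0 \in pred_bidders n M)%:R.
Proof.
move=> vE; apply: revenue_le => [|w /andP[+ _]]; first exact: ler0n.
rewrite /accepts /price inE; case Mw: (M w) => [|j|j] //=.
- rewrite vE; have [<-|_] := eqVneq w i0; first by rewrite Mw.
  by rewrite ge_max ler10.
- have [->|[l lw ->]] := highestP n v w j; first by rewrite ler0n.
  rewrite !vE; have [li0|_ _] := eqVneq l i0; last exact: ler0n.
  by rewrite -li0 eq_sym -val_eqE ltn_eqF // ler10.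
Qed.

(** [B] stands for the bidders with an active rule. Nobody after [i0] can pay [2], so a positive
    price must be the value [1] of [k0], paid later by [i0]; this requires that [k0] let the item
    pass. *)
Lemma revenue_two_values n (M : pa_auction n) p (v : n.-tuple R)
    (B : {set 'I_n}) (i0 k0 : 'I_n) :
  (forall i, tnth v i = if i == i0 then 2 else (i == k0)%:R) ->
  (forall i, i \in B -> exists j, price M p v i = Some (highest (take i v) j)) ->
  (forall i, i \notin B -> ~~ accepts M p v i) ->
  revenue M p v <= ((i0 \in B) && (k0 \notin B))%:R.
Proof.
move=> vE inB outB; apply: revenue_le => [|w /andP[aw nw]]; first exact: ler0n.
have wB : w \in B by apply: contraLR aw => /outB.
have [j pw] := inB _ wB; move: aw; rewrite /accepts pw /=.
have [->|[l lw ->]] := highestP n v w j; first by rewrite ler0n.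
have wl : w == l = false by rewrite eq_sym -val_eqE ltn_eqF.
rewrite !vE; have [li|li] := eqVneq l i0.
  rewrite -li wl; case: (w == k0); rewrite /=; lra.
have [lk|_] := eqVneq l k0; last by rewrite ler0n.
rewrite -lk wl; have [wi _|_] := eqVneq w i0; last by rewrite /= ler10.
rewrite -wi wB /=; suff -> : l \notin B by [].
(* Here [l] is [k0] and [w] is [i0]. Only zeros precede [k0], so an active rule would offer it price
   [0] and it would have taken the item. *)
apply/negP => /inB [j' pl].
have /implyP/(_ lw) := forallP nw l; rewrite /accepts pl => /negP; apply.
have [->|[l' l'l ->]] := highestP n v l j'; rewrite !vE (negbTE li) -lk eqxx.
  exact: ler01.
rewrite -wi -2!val_eqE /= !ltn_eqF //; exact: ltn_trans lw.
Qed.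

Lemma revenue_high_prediction n (M : pa_auction n) (v : n.-tuple R) (i0 k0 : 'I_n) :
  (forall i, tnth v i = if i == i0 then 2 else (i == k0)%:R) ->
  revenue M 3 v <= ((i0 \in any_bidders n M) && (k0 \notin any_bidders n M))%:R.
Proof.
move=> vE; apply: revenue_two_values => // i; rewrite inE /accepts /price.
  by case: (M i) => // j _; exists j.
case: (M i) => //= j _; rewrite vE ge_max negb_and -ltNge.
by case: (i == i0) (i == k0) => [] [] /=; apply/orP; left; lra.
Qed.

Lemma revenue_zero_prediction n (M : pa_auction n) (v : n.-tuple R) (i0 k0 : 'I_n) :
  (forall i, tnth v i = if i == i0 then 2 else (i == k0)%:R) ->
  revenue M 0 v <= ((i0 \in any_bidders n M :|: pred_bidders n M) &&
                    (k0 \notin any_bidders n M :|: pred_bidders n M))%:R.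
Proof.
move=> vE; have v0 : is_instance v.
  by move=> i; rewrite vE; case: (i == i0); rewrite ?ler0n.
apply: revenue_two_values => // i; rewrite !inE /accepts /price.
  case: (M i) => // j _; exists j => //=.
  by rewrite max_r // highest_ge0.
by case: (M i).
Qed.

(** * The two hard instances and the counting bounds they yield *)

Definition spike_instance m : m.+2.-tuple R := [tuple of 1 :: nseq m.+1 0].
Definition double_spike_instance m : m.+2.-tuple R := [tuple of 2 :: 1 :: nseq m 0].

Lemma sorted_ge_nseq m : sorted >=%O (nseq m (0 : R)).
Proof. by case: m => //= m; elim: m => //= m ->; rewrite lexx. Qed.

Lemma highest_sorted (s : seq R) j : sorted >=%O s -> highest s j = nth 0 s j.
Proof. by move=> ss; rewrite /highest sorted_sort //; apply: ge_trans. Qed.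

Lemma highest_spike m : highest (spike_instance m) 0 = 1.
Proof.
by rewrite highest_sorted //=; have := sorted_ge_nseq m.+1; rewrite /= ler01.
Qed.

Lemma highest_double_spike m : highest (double_spike_instance m) 1 = 1.
Proof.
rewrite highest_sorted //=; case: m (sorted_ge_nseq m) => [|m] /= => [_|->].
  by rewrite ler1n.
by rewrite ler01 ler1n.
Qed.

Lemma tnth_spike m (i : 'I_m.+2) : tnth (spike_instance m) i = (i == ord0)%:R.
Proof.
rewrite (tnth_nth 0) /=; case: i => [[|i] lt] //=.
by rewrite (nth_nseq 0 m.+1) if_same.
Qed.

Lemma tnth_double_spike m (i : 'I_m.+2) :
  tnth (double_spike_instance m) i =
  if i == ord0 then 2 else (i == lift ord0 ord0)%:R.
Proof.
rewrite (tnth_nth 0) /=; case: i => [[|[|i]] lt] //=.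
by rewrite nth_nseq if_same.
Qed.

Lemma spike_nonneg m : is_instance (spike_instance m).
Proof. by move=> i; rewrite tnth_spike ler0n. Qed.

Lemma double_spike_nonneg m : is_instance (double_spike_instance m).
Proof. by move=> i; rewrite tnth_double_spike; case: ifP; rewrite ler0n. Qed.

Lemma consistent_card m (alpha : R) (M : pa_auction m.+2) :
  consistent alpha M -> alpha * m.+2%:R <= #|pred_bidders _ M|%:R.
Proof.
move=> /(_ _ (spike_nonneg m)); rewrite highest_spike mulr1.
rewrite /expected_revenue ler_pdivlMr ?ltr0n ?fact_gt0 // => le_rev.
rewrite -(ler_pM2l (_ : 0 < (m.+2)`!%:R :> R)) ?ltr0n ?fact_gt0 //.
have -> : #|pred_bidders _ M|%:R = \sum_i (i \in pred_bidders _ M)%:R :> R.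
  by rewrite -sum1_card natr_sum big_mkcond; apply: eq_bigr => i _; case: (i \in _).
rewrite -(sum_perm_point R _ ord0) mulrCA mulrA mulrC ler_wpM2l //.
apply: le_trans le_rev _; apply: ler_sum => s _.
(* Position [i] receives entry [s i] of the listing, so the value [1] arrives at position
   [(s^-1)%g ord0]. *)
apply: revenue_one_value => i; rewrite tnth_mktuple tnth_spike.
by rewrite -[i == _](inj_eq (@perm_inj _ s)) permKV.
Qed.

(** The positions of the two nonzero values form a uniformly random ordered pair of distinct
    bidders; the right side counts the pairs that can earn, with first member in [B] and second
    outside. *)
Lemma robust_card m (r p : R) (M : pa_auction m.+2) (B : {set 'I_m.+2}) : 0 <= p ->
  (forall (v : m.+2.-tuple R) i0 k0,
     (forall i, tnth v i = if i == i0 then 2 else (i == k0)%:R) ->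
     revenue M p v <= ((i0 \in B) && (k0 \notin B))%:R) ->
  robust r M ->
  r * (m.+2 * m.+1)%:R <= #|B|%:R * (m.+2%:R - #|B|%:R).
Proof.
move=> p0 rev_le /(_ _ _ (double_spike_nonneg m) p0).
rewrite highest_double_spike mulr1.
rewrite /expected_revenue ler_pdivlMr ?ltr0n ?fact_gt0 // => le_rev.
rewrite -(ler_pM2l (_ : 0 < (m.+2)`!%:R :> R)) ?ltr0n ?fact_gt0 //.
have -> : #|B|%:R * (m.+2%:R - #|B|%:R) =
    \sum_i \sum_(k | k != i) ((i \in B) && (k \notin B))%:R :> R.
  transitivity (\sum_(i in B) \sum_(k in ~: B) (1 : R)).
    have <- : (#|B| + #|~: B|)%:R = m.+2%:R :> R by rewrite cardsC card_ord.
    by rewrite !sumr_const natrD addrAC subrr add0r mulr_natl.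
  rewrite big_mkcond; apply: eq_bigr => i _; case: ifP => iB; last first.
    by rewrite big1.
  rewrite big_mkcond [RHS]big_mkcond; apply: eq_bigr => k _; rewrite !inE.
  by have [->|_] := eqVneq k i; rewrite ?iB //=; case: (k \in B).
rewrite -(sum_perm_pair R _ ord0 (lift ord0 ord0)) // mulrCA mulrA mulrC.
rewrite ler_wpM2l //; apply: le_trans le_rev _; apply: ler_sum => s _.
apply: rev_le => i; rewrite tnth_mktuple tnth_double_spike.
by rewrite -2![i == _](inj_eq (@perm_inj _ s)) !permKV.
Qed.

(** * Combining the counting bounds *)

Lemma mul_compl_le (N alpha x : R) : 0 <= N -> 0 <= alpha ->
  x <= N * (1 - alpha) / 2 \/ N * (1 + alpha) / 2 <= x ->
  x * (N - x) <= N ^+ 2 * ((1 - alpha ^+ 2) / 4).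
Proof.
move=> N0 a0 far.
have Na : 0 <= N * alpha by rewrite mulr_ge0.
(* This product is exactly the right side of the goal minus the left side. *)
have : 0 <= (N * (1 - alpha) / 2 - x) * (N * (1 + alpha) / 2 - x).
  by case: far => far; [apply: mulr_ge0|apply: mulr_le0]; nra.
by nra.
Qed.

Lemma robustness_gap m (alpha g : R) (M : pa_auction m.+2) : 0 <= alpha <= 1 ->
  consistent alpha M -> robust ((1 - alpha ^+ 2) / 4 + g) M ->
  m.+2%:R * g <= 1 / 2.
Proof.
move=> /andP[a0 a1] cons rob.
have q_ge := consistent_card _ _ _ cons.
have rob3 := robust_card _ _ _ _ _ (ler0n _ 3) (revenue_high_prediction _ M) rob.
have rob0 := robust_card _ _ _ _ _ (lexx 0) (revenue_zero_prediction _ M) rob.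
move: rob0; rewrite cardsU any_pred_disjoint cards0 subn0 natrD.
move: q_ge rob3; rewrite natrM.
set a : R := #|any_bidders _ _|%:R; set q : R := #|pred_bidders _ _|%:R.
have -> : m.+1%:R = m.+2%:R - 1 :> R by rewrite -[in RHS]natr1 addrK.
have : 2 <= m.+2%:R :> R by rewrite ler_nat.
move: m.+2%:R => N N2 q_ge rob3 rob0.
have key : ((1 - alpha ^+ 2) / 4 + g) * (N * (N - 1)) <= N ^+ 2 * ((1 - alpha ^+ 2) / 4).
  (* If [a] exceeds the lower root, adding [q >= alpha * N] carries [a + q] past the upper one. *)
  have [le|gt] := lerP a (N * (1 - alpha) / 2).
    by apply: le_trans rob3 _; apply: mul_compl_le; [lra|lra|left].
  by apply: le_trans rob0 _; apply: mul_compl_le; [lra|lra|right; lra].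
(* The only slack is [N ^+ 2] against [N * (N - 1)], the price of drawing two distinct positions. It
   leaves [g * (N - 1) <= 1 / 4], and [N <= 2 * (N - 1)] then gives the constant [1 / 2]. *)
have gN : N * (g * (N - 1)) <= N * ((1 - alpha ^+ 2) / 4) by nra.
have g1 : g * (N - 1) <= 1 / 4.
  by move: gN; rewrite ler_pM2l; [nra|lra].
have [g0|g0] := lerP g 0; nra.
Qed.

End Revenue.

Theorem theorem31 (R : realType) (alpha : R) (alpha01 : 0 <= alpha <= 1) :
  ~ exists (g : nat -> R) (M : forall n : nat, pa_auction n),
      (n%:R * g n @[n --> \oo] --> +oo) /\
      (forall n : nat, (2 <= n)%N ->
         consistent alpha (M n) /\
         robust ((1 - alpha ^+ 2) / 4 + g n) (M n)).
Proof.
move=> [g [M [/cvgryPgt /(_ (1 / 2)) [n0 _ large] good]]].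
(* The index [n0.+2] lies past the threshold [n0] and guarantees two bidders. *)
have := large n0.+2 (leq_trans (leqnSn n0) (leqnSn _)).
have [cons rob] := good n0.+2 isT.
by rewrite /= ltNge (robustness_gap _ _ _ _ _ alpha01 cons rob).
Qed.
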